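(* Let $S$ be a Kato surface of intermediate type, let $D$ be its maximal reduced divisor of rational curves, and assume $0<\mu<2$. For $M>0$, the family of Hermitian metrics $$\Omega_t^M=A(t)\,\omega_{\rm tr}+e^{-t}s^\mu\sqrt{-1}\,\Theta\wedge\overline\Theta,\qquad A(t)=2-\mu+e^{-t}\bigl(M-(2-\mu)\bigr),\quad t\ge0,$$ on $S\setminus D$ is flat along the leaves of the canonical foliation on $S\setminus D$ (i.e. the restriction of each $\Omega_t^M$ to each leaf is flat) and collapses homothetically along them, with metric factor $e^{-t}$ (i.e. $\Omega_t^M|_L=e^{-t}\,\Omega_0^M|_L$ for every leaf $L$ and every $t\ge0$).
   Context: Intermediate surfaces. A Kato surface is a minimal compact complex surface of class VII with $b_2>0$ containing a global spherical shell; it is of intermediate type if its rational curves consist of a single cycle together with at least one tree of rational curves meeting the cycle. Let $r=\operatorname{ind}(S)$ be its index. By Dloussky--Oeljeklaus--Toma and Oeljeklaus--Toma, the universal cover of $S\setminus D$ is $X=\mathbb H_\ell\times\mathbb C$, $\mathbb H_\ell=\{w\in\mathbb C:\Re w<0\}$, with coordinates $(w,z)$, and the deck group $\Gamma$ is generated by $$T(w,z)=(w+2\pi\sqrt{-1},z),\qquad G(w,z)=(kw,\lambda z+h(w)),$$ and, if $r>1$, also $\varphi(w,z)=(w-\tfrac{2\pi\sqrt{-1}}{r},\xi z)$. Here $k\ge2$ is an integer, $\lambda\in\mathbb C^*$, $h(w)=Q(e^{-w})$ for a polynomial $Q$, and $\xi=e^{2\pi\sqrt{-1}\sigma_0/r}$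 with $\sigma_0$ the largest exponent occurring in $Q$. Every $\gamma\in\Gamma$ has the form $\gamma(w,z)=(a_\gamma w+b_\gamma,\lambda_\gamma z+h_\gamma(w))$ with $a_\gamma>0$, $\lambda_\gamma\in\mathbb C^*$, $h_\gamma$ holomorphic. The canonical foliation on $S\setminus D$ is induced by $\ker dw=\mathbb C\,\partial_z$ on $X$; its lifted leaves are $\{w_0\}\times\mathbb C$. Notation. $\mu:=-\frac{2\log|\lambda|}{\log k}$; $s:=-\Re w>0$; $\omega_{\rm tr}:=\sqrt{-1}\,\partial\overline\partial(-\log s)=\frac{\sqrt{-1}}{4s^2}dw\wedge d\bar w$. The form $\Theta$. Fix $\chi\in\mathcal C^\infty(X)$, $\chi\ge0$, with $\{\chi\circ\gamma\}_{\gamma\in\Gamma}$ locally finite and $\sum_{\gamma\in\Gamma}\chi(\gamma p)=1$ for all $p\in X$. With $g_0=|dw|^2+|dz|^2$, let $g:=\sum_{\gamma\in\Gamma}\chi(\gamma p)\,\gamma^*g_0$, a $\Gamma$-invariant Hermitian metric, and let $H\subset T_X^{1,0}$ be the $g$-orthogonal complement of $\mathbb C\,\partial_z$. Then $\Theta=dz+B\,dw$ is the unique smooth $(1,0)$-form with $\Theta(\partial_z)=1$ and $\Theta|_H=0$; it satisfies $\gamma^*\Theta=\lambda_\gamma\Theta$ for all $\gamma\in\Gamma$, and $\Omega_t^M$ is $\Gamma$-invariant, so descends to a Hermitian metric on $S\setminus D$. *)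

(* Defs.v *)
From HB Require Import structures.
From mathcomp Require Import all_boot all_order all_algebra.
From mathcomp Require Import complex.
From mathcomp Require Import all_classical all_reals all_analysis.
Import Order.TTheory GRing.Theory Num.Theory.
Import numFieldNormedType.Exports.
Set Implicit Arguments.
Unset Strict Implicit.
Unset Printing Implicit Defensive.

Local Open Scope classical_set_scope.
Local Open Scope ring_scope.
Local Open Scope complex_scope.

(* R[i] packaged as a numClosedFieldType, so that it carries the generic
   norm topology of MathComp-Analysis and is a normed module over itself. *)
Definition Cplx (R : realType) : numClosedFieldType := R[i].
Definition C2 (R : realType) : normedModType (Cplx R) := (Cplx R * Cplx R)%type.

(** ** Smooth functions of real type on complex normed spaces *)

Section Smooth.
Variables (R : realType) (E : normedModType (Cplx R)).

Definition along (f : E -> R) (p v : E) (e : R) : R :=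
  f (p + (e%:C : Cplx R) *: v).

Definition ddir (f : E -> R) (v p : E) : R := derive1 (along f p v) 0.

(* C^n through iterated real directional derivatives; U is meant to be open. *)
Fixpoint Cn_on (U : set E) (n : nat) (f : E -> R) : Prop :=
  (forall p, U p -> {for p, continuous f}) /\
  if n is n'.+1 then
    forall v, (forall p, U p -> derivable (along f p v) 0 1) /\
              Cn_on U n' (ddir f v)
  else True.

Definition smooth_on (U : set E) (f : E -> R) : Prop := forall n, Cn_on U n f.

Definition csmooth_on (U : set E) (f : E -> Cplx R) : Prop :=
  smooth_on U (fun p => complex.Re (f p)) /\
  smooth_on U (fun p => complex.Im (f p)).

End Smooth.

(** ** Complex manifolds modelled on E *)

(* Holomorphy is complex (Frechet) differentiability on open sets.  [cinv i]
   is total but only meaningful on the image of the chart; [cpref x] is a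
   preferred chart around x. *)
Record cmanifold (R : realType) (E : normedModType (Cplx R)) := CManifold {
  cpoint :> topologicalType;
  cidx : Type;
  cdom : cidx -> set cpoint;
  cchart : cidx -> cpoint -> E;
  cinv : cidx -> E -> cpoint;
  cpref : cpoint -> cidx;
  cdom_open : forall i, open (cdom i);
  cdom_cpref : forall x, cdom (cpref x) x;
  cchartK : forall i x, cdom i x -> cinv i (cchart i x) = x;
  cimage_open : forall i, open (cchart i @` cdom i);
  cchart_continuous : forall i x, cdom i x -> {for x, continuous (cchart i)};
  cinv_continuous : forall i p, (cchart i @` cdom i) p ->
    {for p, continuous (cinv i)};
  ctransition_holomorphic : forall i j x, cdom i x -> cdom j x ->
    differentiable (cchart j \o cinv i) (cchart i x) }.

Arguments cdom {R E} c _ _.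
Arguments cchart {R E} c _ _.
Arguments cinv {R E} c _ _.
Arguments cpref {R E} c _.

Section Model.
Variables (R : realType) (E : normedModType (Cplx R)).

Let model_image_open (i : unit) : open ((fun x : E => x) @` [set: E]).
Proof. by rewrite image_id; exact: openT. Qed.

Let model_transition (i j : unit) (x : E) : [set: E] x -> [set: E] x ->
  differentiable ((fun y : E => y) \o (fun y : E => y)) x.
Proof. by move=> _ _; exact: ex_diff. Qed.

Definition model : cmanifold E :=
  @CManifold R E E unit (fun _ => setT) (fun _ x => x) (fun _ x => x)
    (fun _ => tt) (fun _ => openT) (fun _ => I) (fun _ _ _ => erefl)
    model_image_open (fun _ x _ => @cvg_id _ (nbhs x)) (fun _ p _ => @cvg_id _ (nbhs p))
    model_transition.

End Model.

Section Maps.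
Variables (R : realType) (E F : normedModType (Cplx R)).
Variables (M : cmanifold E) (N : cmanifold F).

Definition holomorphic_on (U : set M) (f : M -> N) : Prop :=
  forall x, U x -> {for x, continuous f} /\
    forall i j, cdom M i x -> cdom N j (f x) ->
      differentiable (cchart N j \o f \o cinv M i) (cchart M i x).

End Maps.

Section Biholomorphic.
Variables (R : realType) (E : normedModType (Cplx R)) (M N : cmanifold E).

Definition biholomorphic_on (U : set M) (f : M -> N) : Prop :=
  [/\ open U, open (f @` U), holomorphic_on U f &
      exists2 g : N -> M, (forall x, U x -> g (f x) = x)
                        & holomorphic_on (f @` U) g].

End Biholomorphic.

(** ** Betti numbers (singular cohomology with real coefficients) *)

Section Betti.
Variables (R : realType) (S : topologicalType).

Definition simplex (n : nat) : set 'rV[R]_n.+1 :=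
  [set x | (forall i, 0 <= x 0 i) /\ \sum_i x 0 i = 1].
Arguments simplex n _ : clear implicits.

Definition singular (n : nat) (s : 'rV[R]_n.+1 -> S) : Prop :=
  {within simplex n, continuous s}.

Definition face (n : nat) (i : 'I_n.+2) (x : 'rV[R]_n.+1) : 'rV[R]_n.+2 :=
  \row_j (if unlift i j is Some j' then x 0 j' else 0).

(* Singular simplices are represented by total maps, so cochains must not see
   values off the standard simplex. *)
Definition cochain (n : nat) (c : ('rV[R]_n.+1 -> S) -> R) : Prop :=
  forall s s', {in simplex n, s =1 s'} -> c s = c s'.

Definition cobd (n : nat) (c : ('rV[R]_n.+1 -> S) -> R)
    (s : 'rV[R]_n.+2 -> S) : R :=
  \sum_(i < n.+2) (-1) ^+ i * c (s \o face i).

Definition cocycle (n : nat) (c : ('rV[R]_n.+1 -> S) -> R) : Prop :=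
  cochain c /\ forall s, singular s -> cobd c s = 0.

Definition coboundary (n : nat) (c : ('rV[R]_n.+2 -> S) -> R) : Prop :=
  exists2 b : ('rV[R]_n.+1 -> S) -> R,
    cochain b & forall s, singular s -> c s = cobd b s.

(* [betti n d] : the (n+1)-st Betti number of S is d. *)
Definition betti (n d : nat) : Prop :=
  exists c : 'I_d -> ('rV[R]_n.+2 -> S) -> R,
    (forall j, cocycle (c j)) /\
    forall c', cocycle c' ->
      exists! a : {ffun 'I_d -> R},
        coboundary (fun s => c' s - \sum_(j < d) a j * c j s).

End Betti.

(** ** Complex surfaces *)

Section Surfaces.
Variable R : realType.
Local Notation C := (Cplx R).
Local Notation surface := (cmanifold (C2 R)).

Definition det2 (u v : C2 R) : C := u.1 * v.2 - u.2 * v.1.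

Definition jac (f : C2 R -> C2 R) (p : C2 R) : C :=
  det2 ('d f p ((1, 0) : C2 R)) ('d f p ((0, 1) : C2 R)).

Definition flat_cocycle (S : surface) (c : cidx S -> cidx S -> S -> C) : Prop :=
  (forall i j x, cdom S i x -> cdom S j x ->
     c i j x != 0 /\ \forall y \near x, c i j y = c i j x) /\
  forall i j l x, cdom S i x -> cdom S j x -> cdom S l x ->
     c i j x * c j l x = c i l x.

(* Holomorphic sections of K^m (x) L, with L the flat line bundle of the
   locally constant cocycle c: locally f_i (dw_i /\ dz_i)^m. *)
Definition twisted_section (S : surface) (c : cidx S -> cidx S -> S -> C)
    (m : int) (f : cidx S -> C2 R -> C) : Prop :=
  (forall i x, cdom S i x -> differentiable (f i) (cchart S i x)) /\
  forall i j x, cdom S i x -> cdom S j x ->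
    f i (cchart S i x) =
    c i j x * jac (cchart S j \o cinv S i) (cchart S i x) ^ m
            * f j (cchart S j x).

Definition kodaira_minus_infinity (S : surface) : Prop :=
  forall (m : nat) f, (0 < m)%N ->
    twisted_section (fun _ _ _ => 1) m%:Z f ->
    forall i x, cdom S i x -> f i (cchart S i x) = 0.

Definition compact_surface (S : surface) : Prop :=
  [/\ hausdorff_space S, compact [set: S] & connected [set: S]].

Definition class_VII (S : surface) : Prop :=
  betti R S 0 1 /\ kodaira_minus_infinity S.

(* S is not the blow-up of a surface at a point. *)
Definition minimal (S : surface) : Prop :=
  ~ exists (S' : surface) (q : S') (f : S -> S'),
      [/\ hausdorff_space S', holomorphic_on [set: S] f,
          biholomorphic_on (f @^-1` [set~ q]) f /\
          f @` (f @^-1` [set~ q]) = [set~ q]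
        & exists x y, [/\ x <> y, f x = q & f y = q]].

Definition norm2 (p : C2 R) : R :=
  (ComplexField.Normc.normc p.1) ^+ 2 + (ComplexField.Normc.normc p.2) ^+ 2.

Definition has_gss (S : surface) : Prop :=
  exists (a b : R) (f : C2 R -> S),
    let A := [set p : C2 R | a < norm2 p < b] in
    [/\ 0 < a < 1, 1 < b,
        @biholomorphic_on R (C2 R) (model (C2 R)) S A f
      & connected (~` (f @` A))].

Definition kato_surface (S : surface) : Prop :=
  [/\ compact_surface S, minimal S, class_VII S,
      exists2 b2, (0 < b2)%N & betti R S 1 b2 & has_gss S].

(** *** Rational curves *)

(* A map P^1 -> S is given on the two affine charts of P^1; (b, z) stands for
   the point of coordinate z in the chart b. *)
Definition P1 : Type := (bool * C)%type.

Definition same_point (p q : P1) : Prop :=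
  if p.1 == q.1 then p.2 = q.2 else p.2 * q.2 = 1.

Section Curves.
Variable S : surface.
Implicit Types (f g : P1 -> S) (X Y : set S).

(* f is the normalization map P^1 -> X. *)
Definition normalization f X : Prop :=
  [/\ forall b, @holomorphic_on R C _ (model C) S [set: C] (fun z => f (b, z)),
      (forall p q, same_point p q -> f p = f q),
      finite_set [set pq : P1 * P1 |
                   ~ same_point pq.1 pq.2 /\ f pq.1 = f pq.2]
    & X = range f].

Definition rational_curve X : Prop := exists f, normalization f X.

Definition velocity f (p : P1) : C2 R :=
  'd (fun z : C => cchart S (cpref S (f p)) (f (p.1, z))) (p.2) 1.

Definition immersed f : Prop := forall p, velocity f p != 0.

Definition smooth_curve X : Prop :=
  exists f, [/\ normalization f X, immersed f
              & forall p q, f p = f q -> same_point p q].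

Definition nodal_curve X : Prop :=
  exists f, [/\ normalization f X, immersed f &
    exists p q,
      [/\ ~ same_point p q, f p = f q, det2 (velocity f p) (velocity f q) != 0
        & forall p' q', f p' = f q' ->
            [\/ same_point p' q',
                same_point p' p /\ same_point q' q
              | same_point p' q /\ same_point q' p]]].

Definition transverse X Y : Prop :=
  exists f g, [/\ normalization f X, normalization g Y
    & forall p q, f p = g q -> det2 (velocity f p) (velocity g q) != 0].

(* The rational curves of S form one cycle together with at least one tree
   meeting it.  Conditions on the dual graph: it is connected, it has a vertex
   off the cycle, and its only circuit is the cycle [cyc]; a cycle of length 1
   is a nodal curve, and one of length 2 is a pair of smooth curves meeting in
   two points. *)
Definition cycle_with_trees : Prop :=
  exists (n : nat) (X : 'I_n -> set S) (cyc : seq 'I_n),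
    let e := [rel i j : 'I_n | (i != j) && `[< X i `&` X j !=set0 >]] in
    [/\ injective X /\ (forall Y, rational_curve Y <-> exists i, Y = X i),
        [/\ (0 < size cyc)%N, uniq cyc, ((1 < size cyc)%N -> cycle e cyc)
          & forall p, (2 < size p)%N -> ucycle e p -> p =i cyc],
        (forall i j, connect e i j) /\ (exists i, i \notin cyc),
        (forall i, if cyc == [:: i] then nodal_curve (X i)
                   else smooth_curve (X i))
      & (forall i j, e i j -> transverse (X i) (X j) /\
           
           (X i `&` X j #=
             `I_(if [&& size cyc == 2, i \in cyc & j \in cyc]
                 then 2 else 1))%card)
        /\ (forall i j l, i != j -> j != l -> i != l ->
              X i `&` X j `&` X l = set0)].

(* Support of the maximal reduced divisor of rational curves. *)
Definition rational_divisor : set S :=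
  [set x | exists2 X, rational_curve X & X x].

End Curves.

Definition intermediate_kato (S : surface) : Prop :=
  kato_surface S /\ cycle_with_trees S.

(* K^{-m} (x) L has a nonzero section for some flat L; charts are allowed to be
   changed since L need not trivialize on the given ones. *)
Definition has_twisted_anticanonical (S : surface) (m : nat) : Prop :=
  exists (S' : surface) (F : S' -> S) c f,
    [/\ biholomorphic_on [set: S'] F, range F = [set: S],
        flat_cocycle c, @twisted_section S' c (- m%:Z) f
      & exists i x, cdom S' i x /\ f i (cchart S' i x) != 0].

Definition is_index (S : surface) (r : nat) : Prop :=
  [/\ (0 < r)%N, has_twisted_anticanonical S r
    & forall m, (0 < m)%N -> has_twisted_anticanonical S m -> (r <= m)%N].

End Surfaces.

Arguments rational_divisor {R} S _.

(** ** The uniformization of S \ D *)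

Section Uniformization.
Variable R : realType.
Local Notation C := (Cplx R).

Definition cexp (z : C) : C :=
  (expR (complex.Re z))%:C * (cos (complex.Im z) +i* sin (complex.Im z)).

Definition halfplane : set C := [set w | complex.Re w < 0].

Definition Xspace : set (C2 R) := [set p | halfplane p.1].

Section Deck.
Variables (k : nat) (lam : C) (Q : {poly C}) (r : nat).

Definition hfun (w : C) : C := Q.[cexp (- w)].
Definition sigma0 : nat := (size Q).-1.
Definition xi : C := cexp (0 +i* (2 * pi * sigma0%:R / r%:R)).

Definition T_gen (p : C2 R) : C2 R := (p.1 + (0 +i* (2 * pi)), p.2).
Definition G_gen (p : C2 R) : C2 R := (k%:R * p.1, lam * p.2 + hfun p.1).
Definition phi_gen (p : C2 R) : C2 R :=
  (p.1 - (0 +i* (2 * pi / r%:R)), xi * p.2).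

(* The generators extend to automorphisms of C^2; two elements of the group
   agreeing on the open set X are equal, so nothing is lost by regarding the
   group as acting on C^2. *)
Inductive deck : (C2 R -> C2 R) -> Prop :=
| deck_id : deck id
| deck_T : deck T_gen
| deck_G : deck G_gen
| deck_phi : (1 < r)%N -> deck phi_gen
| deck_comp f g : deck f -> deck g -> deck (f \o g)
| deck_inv f g : deck f -> cancel f g -> cancel g f -> deck g.

(* ppi : X -> S \ D is a holomorphic covering with deck group [deck]; it is the
   universal one as X is simply connected. *)
Definition uniformization (S : cmanifold (C2 R)) (ppi : C2 R -> S) : Prop :=
  [/\ ppi @` Xspace = ~` rational_divisor S,
      (forall p q, Xspace p -> Xspace q ->
         (ppi p = ppi q <-> exists2 gam, deck gam & gam p = q))
    & forall p, Xspace p -> exists U : set (C2 R),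
        [/\ U p, U `<=` Xspace,
            @biholomorphic_on R (C2 R) (model (C2 R)) S U ppi
          & forall gam, deck gam -> (exists2 q, U q & U (gam q)) -> gam = id]].

(** ** The form Theta *)

Definition cutoff (chi : C2 R -> R) : Prop :=
  [/\ smooth_on Xspace chi, (forall p, Xspace p -> 0 <= chi p),
      (forall p, Xspace p -> exists2 U, nbhs p U &
         finite_set [set gam | deck gam /\
            exists q, [/\ U q, Xspace q & chi (gam q) != 0]])
    & forall p, Xspace p -> \sum_(gam \in deck) chi (gam p) = 1].

(* A (1,1)-form i * sum h_jk dz_j /\ dzbar_k is identified throughout with the
   Hermitian form sum h_jk u_j (v_k)^*. *)
Definition std_herm (u v : C2 R) : C := u.1 * v.1^* + u.2 * v.2^*.

Definition averaged (chi : C2 R -> R) (p u v : C2 R) : C :=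
  \sum_(gam \in deck)
     ((chi (gam p))%:C * std_herm ('d gam p u) ('d gam p v) : C).

Definition Theta (B : C2 R -> C) (p u : C2 R) : C := u.2 + B p * u.1.

(* Theta = dz + B dw vanishes on the orthogonal of d/dz for the averaged
   metric; Theta(d/dz) = 1 is built in the shape of Theta. *)
Definition horizontal (chi : C2 R -> R) (B : C2 R -> C) : Prop :=
  csmooth_on Xspace B /\
  forall p u, Xspace p -> averaged chi p u ((0, 1) : C2 R) = 0 ->
    Theta B p u = 0.

End Deck.

(** ** The metrics *)

Definition mu (k : nat) (lam : C) : R :=
  - (2 * ln (ComplexField.Normc.normc lam)) / ln k%:R.

Definition s_of (p : C2 R) : R := - complex.Re p.1.

Definition omega_tr (p u v : C2 R) : C :=
  ((4 * s_of p ^+ 2)^-1)%:C * (u.1 * v.1^*).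

Definition Acoef (m M t : R) : R := 2 - m + expR (- t) * (M - (2 - m)).

Definition Omega (m M : R) (B : C2 R -> C) (t : R) (p u v : C2 R) : C :=
  (Acoef m M t)%:C * omega_tr p u v
  + (expR (- t) * (s_of p `^ m))%:C * (Theta B p u * (Theta B p v)^*).

End Uniformization.

Section HermitianMetric.
Variables (R : realType) (E : normedModType (Cplx R)) (M : cmanifold E).

(* [hval i x u v] : value at x on the vectors with coordinates u and v in the
   chart i. *)
Record hmetric (V : set M) := HMetric {
  hval :> cidx M -> M -> E -> E -> Cplx R;
  hval_linear : forall i x, V x -> cdom M i x -> forall (a : Cplx R) u v w,
    hval i x (a *: u + v) w = a * hval i x u w + hval i x v w;
  hval_sym : forall i x, V x -> cdom M i x -> forall u v,
    hval i x v u = (hval i x u v)^*;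
  hval_pos : forall i x, V x -> cdom M i x -> forall u, u != 0 ->
    0 < hval i x u u;
  hval_smooth : forall i u v, csmooth_on (cchart M i @` (V `&` cdom M i))
    (fun p => hval i (cinv M i p) u v);
  hval_compat : forall i j x, V x -> cdom M i x -> cdom M j x -> forall u v,
    let tau := cchart M j \o cinv M i in
    hval i x u v =
    hval j x ('d tau (cchart M i x) u) ('d tau (cchart M i x) v) }.

Definition pullback (V : set M) (F : normedModType (Cplx R)) (f : F -> M)
    (h : hmetric V) (p u v : F) : Cplx R :=
  let i := cpref M (f p) in
  h i (f p) ('d (cchart M i \o f) p u) ('d (cchart M i \o f) p v).

End HermitianMetric.

(** ** Flatness along the leaves *)

Section Leaves.
Variables (R : realType).
Local Notation C := (Cplx R).

Definition laplacian (f : C -> R) (z : C) : R :=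
  ddir (ddir f 1) 1 z + ddir (ddir f 'i) 'i z.

(* Gaussian curvature of rho |dz|^2. *)
Definition gauss_curvature (rho : C -> R) (z : C) : R :=
  - laplacian (fun y => ln (rho y)) z / (2 * rho z).

Definition flat_density (rho : C -> R) : Prop :=
  [/\ smooth_on setT rho, (forall z, 0 < rho z)
    & forall z, gauss_curvature rho z = 0].

Variables (S : cmanifold (C2 R)) (ppi : C2 R -> S).

(* The leaves of the foliation of S \ D induced by ker dw are the images of
   {w0} x C with Re w0 < 0; they are parametrized by z. *)
Definition leaf_map (w0 : C) (z : C) : S := ppi (w0, z).

Definition flat_along_leaves (V : set S) (h : hmetric V) : Prop :=
  forall w0, halfplane w0 ->
    flat_density (fun z => complex.Re (pullback (leaf_map w0) h z 1 1)).

Definition homothetic_along_leaves (V : set S) (c : R) (h h0 : hmetric V)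
    : Prop :=
  forall w0, halfplane w0 -> forall z u v,
    pullback (leaf_map w0) h z u v = c%:C * pullback (leaf_map w0) h0 z u v.

End Leaves.

(* Main.v *)
(** Along a lifted leaf {w0} x C one has dw = 0 and Theta = dz, so the metric
    restricts to the constant multiple e^{-t} s^mu of |dz|^2, where
    s = - Re w0: it is flat, and depends on t only through the factor e^{-t}. *)

Require Import Defs.
From mathcomp Require Import all_boot all_order all_algebra.
From mathcomp Require Import complex.
From mathcomp Require Import all_classical all_reals all_analysis.
Import Order.TTheory GRing.Theory Num.Theory.
Import numFieldNormedType.Exports.
Local Open Scope classical_set_scope.
Local Open Scope ring_scope.
Local Open Scope complex_scope.

Lemma ddir_cst (R : realType) (E : normedModType (Cplx R)) (a : R) (v : E) :
  ddir (fun _ => a) v = fun _ => 0.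
Proof. by apply/funext => p; rewrite /ddir /along derive1_cst. Qed.

Lemma smooth_on_cst (R : realType) (E : normedModType (Cplx R)) (U : set E)
  (a : R) : smooth_on U (fun _ => a).
Proof.
(* The constant is generalised because the induction hypothesis is applied to the derivative, which
   is the constant 0 and not [a]. *)
move=> n; elim: n a => [|n IHn] a; split=> //; try by move=> p _; exact: cvg_cst.
move=> v; split; last by rewrite ddir_cst.
by move=> p _; exact: derivable_cst.
Qed.

Lemma flat_density_cst (R : realType) (a : R) :
  0 < a -> flat_density (fun _ => a).
Proof.
move=> a0; split=> // [|z]; first exact: smooth_on_cst.
by rewrite /gauss_curvature /laplacian !ddir_cst addr0 oppr0 mul0r.
Qed.

(** The covering is biholomorphic on a neighbourhood of [p], and holomorphy there, read in charts,
    is the claimed differentiability. *)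
Lemma uniformization_differentiable (R : realType) (S : cmanifold (C2 R))
    (k : nat) (lam : Cplx R) (Q : {poly Cplx R}) (r : nat) (ppi : C2 R -> S)
    (p : C2 R) (i : cidx S) :
  uniformization k lam Q r ppi -> Xspace p -> cdom S i (ppi p) ->
  differentiable (cchart S i \o ppi) p.
Proof.
case=> _ _ /[apply] -[U [Up _ [_ _ hol _] _]] Si.
(* [tt] is the single chart of [model]; its chart map and inverse are the identity, so they
   disappear by conversion. *)
exact: (hol p Up).2 tt i I Si.
Qed.

(** Chain rule: the leaf map is [ppi] after the inclusion [y |-> (w0, y)], whose differential is
    [u |-> (0, u)]. Both pullbacks read the metric at the same point in the same preferred chart, so
    only the differentials have to be compared. *)
Lemma pullback_leaf_map (R : realType) (S : cmanifold (C2 R))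
    (ppi : C2 R -> S) (V : set S) (h : hmetric V) (w0 z u v : Cplx R) :
  differentiable (cchart S (cpref S (ppi (w0, z))) \o ppi)
    ((w0, z) : C2 R) ->
  pullback (leaf_map ppi w0) h z u v =
  pullback ppi h ((w0, z) : C2 R) ((0, u) : C2 R) ((0, v) : C2 R).
Proof.
move=> dpi; rewrite /pullback /leaf_map.
have dleaf : is_diff z (fun y : Cplx R => (w0, y) : C2 R)
    (fun y => (0, y) : C2 R).
  exact: is_diff_eq.
suff E u' : 'd (cchart S (cpref S (ppi (w0, z))) \o (fun y => ppi (w0, y))) z u'
    = 'd (cchart S (cpref S (ppi (w0, z))) \o ppi) ((w0, z) : C2 R)
        ((0, u') : C2 R).
  by rewrite !E.
rewrite (_ : _ \o (fun y => ppi (w0, y)) =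
  (cchart S (cpref S (ppi (w0, z))) \o ppi) \o
  (fun y : Cplx R => (w0, y) : C2 R)) // diff_comp //.
by rewrite /= diff_val.
Qed.

(** [omega_tr] and the [B] part of [Theta] have the first coordinate of a vector as a factor, and it
    is 0 on vertical vectors. *)
Lemma Omega_vertical (R : realType) (m M t : R) (B : C2 R -> Cplx R)
    (p : C2 R) (u v : Cplx R) :
  Omega m M B t p ((0, u) : C2 R) ((0, v) : C2 R) =
  (expR (- t) * s_of p `^ m)%:C * (u * v^*).
Proof. by rewrite /Omega /omega_tr /Theta /= !(mulr0, mul0r) !addr0 add0r. Qed.

Theorem proposition4 (R : realType) (S : cmanifold (C2 R))
    (hS : intermediate_kato S) (r : nat) (hr : is_index S r)
    (k : nat) (hk : (2 <= k)%N) (lam : Cplx R) (hlam : lam != 0)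
    (Q : {poly Cplx R}) (hQ : Q != 0)
    (ppi : C2 R -> S) (hpi : uniformization k lam Q r ppi)
    (hmu : 0 < mu k lam < 2)
    (chi : C2 R -> R) (hchi : cutoff k lam Q r chi)
    (B : C2 R -> Cplx R) (hB : horizontal k lam Q r chi B)
    (M : R) (hM : 0 < M)
    (OmegaS : R -> hmetric (~` rational_divisor S))
    (hOmegaS : forall t : R, 0 <= t -> forall p u v, Xspace p ->
       pullback ppi (OmegaS t) p u v = Omega (mu k lam) M B t p u v) :
  (forall t : R, 0 <= t -> flat_along_leaves ppi (OmegaS t)) /\
  (forall t : R, 0 <= t ->
     homothetic_along_leaves ppi (expR (- t)) (OmegaS t) (OmegaS 0)).
Proof.
(* Both claims follow from this explicit formula, whose right-hand side does not depend on [z]. *)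
have leafE t w0 z u v : 0 <= t -> halfplane w0 ->
    pullback (leaf_map ppi w0) (OmegaS t) z u v =
    (expR (- t) * (- complex.Re w0) `^ mu k lam)%:C * (u * v^*).
  move=> t0 hw0.
  rewrite pullback_leaf_map; first by rewrite hOmegaS // Omega_vertical.
  by apply: uniformization_differentiable hpi _ _ => //; exact: cdom_cpref.
split=> t t0 w0 hw0; last first.
  (* At time 0 the exponential is 1, so the coefficient of the initial metric is the bare power, and
     [expR (- t)] splits off. *)
  by move=> z u v; rewrite !leafE // oppr0 expR0 mul1r rmorphM mulrA.
have -> : (fun z => complex.Re (pullback (leaf_map ppi w0) (OmegaS t) z 1 1)) =
    fun _ => expR (- t) * (- complex.Re w0) `^ mu k lam.
  by apply/funext => z; rewrite leafE // conjC1 !mulr1.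
(* The base of the power is positive because [w0] lies in the left half-plane. *)
by apply: flat_density_cst; rewrite mulr_gt0 ?expR_gt0 // powR_gt0 // oppr_gt0.
Qed.
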